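(* Let $a>b>0$ be real numbers and let $S:=\{x+iy: x,y\in\mathbb{R},\ (x^2/a^2)+(y^2/b^2)\le 1\}\subset\mathbb{C}$. Then there exists a $2\times 2$ complex matrix $T$ (viewed as an operator on the Hilbert space $\mathbb{C}^2$) such that $W(T)\subset S$, but $(S,0)$ is not a $W$-spectral pair for $T$.
   Context: For a bounded linear operator $T$ on a complex Hilbert space $H$, $\sigma(T)$ is its spectrum, and its numerical range and numerical radius are $W(T):=\{\langle Tx,x\rangle: x\in H,\ \|x\|=1\}$ and $w(T):=\sup_{z\in W(T)}|z|$. Definition ($W$-spectral pair). Let $T$ be a bounded linear operator on $H$, let $S\subset\mathbb{C}$ and let $z_0\in S$. The pair $(S,z_0)$ is a $W$-spectral pair for $T$ if $\sigma(T)\subset S$ and if, for every rational function $f$ with poles outside $\overline{S}$ and satisfying $f(z_0)=0$, we have $w(f(T))\le\sup_{z\in S}|f(z)|$. *)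

(* Defs.v *)
From mathcomp Require Import all_boot all_order all_algebra.
From mathcomp Require Import complex.
From mathcomp Require Import all_classical all_reals all_analysis.

Set Implicit Arguments.
Unset Strict Implicit.
Unset Printing Implicit Defensive.

Import Order.TTheory GRing.Theory Num.Theory.
Import numFieldNormedType.Exports.

Local Open Scope classical_set_scope.
Local Open Scope ring_scope.

(* The modulus of a complex number, as an element of R; on R[i] the library
   norm `|z| takes its values in R[i]. *)
Definition cmod (R : realType) (z : R[i]) : R := complex.Re `|z|.

(* Operators on the Hilbert space C^n are matrices acting on column vectors.
   The inner product is linear in its first argument; dotmx is the library's
   sesquilinear product of row vectors, hence the transpositions. *)
Definition inner (R : realType) (n : nat) (x y : 'cV[R[i]]_n) : R[i] :=
  dotmx x^T y^T.

Definition hnorm (R : realType) (n : nat) (x : 'cV[R[i]]_n) : R[i] :=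
  sqrtC (inner x x).

Definition spectrum (R : realType) (n : nat) (T : 'M[R[i]]_n) : set R[i] :=
  [set z | z%:M - T \notin unitmx].

Definition numerical_range (R : realType) (n : nat) (T : 'M[R[i]]_n) :
    set R[i] :=
  [set inner (T *m x) x | x in [set x : 'cV[R[i]]_n | hnorm x = 1]].

(* The supremum of |f| over A, possibly +oo. *)
Definition sup_mod (R : realType) (A : set R[i]) (f : R[i] -> R[i]) : \bar R :=
  ereal_sup [set (cmod (f z))%:E | z in A].

Definition numerical_radius (R : realType) (n : nat) (T : 'M[R[i]]_n) :
    \bar R :=
  sup_mod (numerical_range T) id.

(* A rational function in lowest terms, so that its (finite) poles are exactly
   the roots of its denominator. *)
Record ratfun (F : fieldType) := RatFun {
  rnum : {poly F};
  rden : {poly F};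
  rden_neq0 : rden != 0;
  rcoprime : coprimep rnum rden
}.

Definition is_pole (F : fieldType) (f : ratfun F) (z : F) : Prop :=
  root (rden f) z.

Definition reval (F : fieldType) (f : ratfun F) (z : F) : F :=
  (rnum f).[z] / (rden f).[z].

(* f(T) = p(T) q(T)^-1; q(T) is invertible as soon as no pole of f lies in the
   spectrum of T. *)
Definition reval_mx (F : fieldType) (n : nat) (f : ratfun F)
    (T : 'M[F]_n.+1) : 'M[F]_n.+1 :=
  horner_mx T (rnum f) *m invmx (horner_mx T (rden f)).

(* The topology of the complex plane is carried by the alias R[i]^o. *)
Definition cclosure (R : realType) (S : set R[i]) : set R[i] :=
  closure (S : set (R[i])^o).

Definition W_spectral_pair (R : realType) (n : nat) (T : 'M[R[i]]_n.+1)
    (S : set R[i]) (z0 : R[i]) : Prop :=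
  [/\ S z0,
      spectrum T `<=` S &
      forall f : ratfun R[i],
        (forall z, is_pole f z -> ~ cclosure S z) ->
        reval f z0 = 0 ->
        (numerical_radius (reval_mx f T) <= sup_mod S (reval f))%E].

Definition ellipse (R : realType) (a b : R) : set R[i] :=
  [set z | (complex.Re z) ^+ 2 / a ^+ 2 + (complex.Im z) ^+ 2 / b ^+ 2 <= 1].

(* Main.v *)
(** Idea: take the matrix [T] with zero diagonal and off-diagonal entries
    [a + b], [a - b]: its numerical range is the ellipse itself, and
    [T^2 = (a^2 - b^2) I].  For [f(z) = z - e z^3] this gives
    [f(T) = (1 - e (a^2 - b^2)) T], of numerical radius
    [(1 - e (a^2 - b^2)) a].  On the other hand, for small [e > 0] the maximum
    of [|f|] over the ellipse is governed by the points [+-a] where [|z|] is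
    largest, and there [|f|] is only [(1 - e a^2) a]. *)
Require Import Defs.
From mathcomp Require Import all_boot all_order all_algebra.
From mathcomp Require Import complex.
From mathcomp Require Import all_classical all_reals all_analysis.
From mathcomp Require Import ring lra.

Import Order.TTheory GRing.Theory Num.Theory.
Import numFieldNormedType.Exports.

Local Open Scope classical_set_scope.
Local Open Scope ring_scope.

Lemma cmod_sqr (R : realType) (z : R[i]) :
  cmod z ^+ 2 = complex.Re z ^+ 2 + complex.Im z ^+ 2.
Proof. by rewrite /cmod normc_def /= sqr_sqrtr // addr_ge0 ?sqr_ge0. Qed.

Lemma cmod_ge0 (R : realType) (z : R[i]) : 0 <= cmod z.
Proof. by rewrite /cmod normc_def /= sqrtr_ge0. Qed.

Lemma cmod_real (R : realType) (r : R) : cmod r%:C%C = `|r|.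
Proof. by rewrite /cmod normc_def /= expr0n addr0 sqrtr_sqr. Qed.

Lemma inner2 (R : realType) (x y : 'cV[R[i]]_2) :
  inner x y = x ord0 ord0 * conjc (y ord0 ord0)
    + x (lift ord0 ord0) ord0 * conjc (y (lift ord0 ord0) ord0).
Proof. by rewrite /inner dotmxE !mxE big_ord_recl big_ord1 !mxE. Qed.

Lemma hnorm_eq1 (R : realType) (n : nat) (x : 'cV[R[i]]_n) :
  hnorm x = 1 <-> inner x x = 1.
Proof.
rewrite /hnorm; split=> [h|->]; last exact: sqrtC1.
by rewrite -[LHS]sqrtCK h expr1n.
Qed.

Definition antidiag {R : realType} (u v : R) : 'M[R[i]]_2 :=
  \matrix_(i, j) if i == j then 0 else if i == 0 then u%:C%C else v%:C%C.

Lemma inner_antidiag (R : realType) (u v : R) (x : 'cV[R[i]]_2) :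
  inner (antidiag u v *m x) x =
    u%:C%C * x (lift ord0 ord0) ord0 * conjc (x ord0 ord0)
    + v%:C%C * x ord0 ord0 * conjc (x (lift ord0 ord0) ord0).
Proof.
by rewrite inner2 !mxE !big_ord_recl !big_ord0 !mxE /= !mul0r !addr0 add0r.
Qed.

(** With [w = x1 * conj x0], the value at [x] is [2 a Re w + 2 i b Im w], so the ellipse expression
    equals [4 |w|^2 = 4 |x0|^2 |x1|^2], at most [(|x0|^2 + |x1|^2)^2 = 1]. *)
Lemma numerical_range_antidiag (R : realType) (a b : R) : 0 < a -> 0 < b ->
  numerical_range (antidiag (a + b) (a - b)) `<=` ellipse a b.
Proof.
move=> a0 b0 _ [x /hnorm_eq1 + <-]; rewrite inner_antidiag inner2 /ellipse /=.
case: (x ord0 ord0) => p q; case: (x (lift ord0 ord0) ord0) => r s.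
move=> /(congr1 (@complex.Re R)) /= n1.
have an0 : a != 0 by rewrite gt_eqF.
have bn0 : b != 0 by rewrite gt_eqF.
pose P := p ^+ 2 + q ^+ 2; pose Q := r ^+ 2 + s ^+ 2.
have PQ : P + Q = 1 by rewrite -[RHS]n1 /P /Q; ring.
rewrite [leLHS](_ : _ = 4 * P * Q); last by rewrite /P /Q; field; apply/andP.
have -> : 4 * P * Q = (P + Q) ^+ 2 - (P - Q) ^+ 2 by ring.
by rewrite PQ expr1n lerBlDr lerDl sqr_ge0.
Qed.

(** The unit vector with two equal coordinates attains this value. *)
Lemma antidiag_numerical_radius_ge (R : realType) (u v : R) :
  ((`|(u + v) / 2|)%:E <= numerical_radius (antidiag u v))%E.
Proof.
pose x : 'cV[R[i]]_2 := const_mx (Num.sqrt 2^-1)%:C%C.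
have s2 : Num.sqrt 2^-1 * Num.sqrt 2^-1 = 2^-1 :> R.
  by rewrite -expr2 sqr_sqrtr ?invr_ge0 ?ler0n.
have x1 : hnorm x = 1.
  apply/hnorm_eq1; rewrite inner2 !mxE conjc_real -rmorphM /= s2 -rmorphD /=.
  by rewrite -[RHS]/(1%:C%C); congr (_%:C%C); field.
apply: ereal_sup_ubound; exists (inner (antidiag u v *m x) x); first by exists x.
rewrite inner_antidiag !mxE conjc_real -!mulrA -!rmorphM /= s2 -rmorphD /=.
by rewrite cmod_real mulrDl.
Qed.

(** The square of [antidiag u v] is [u v] times the identity, so its cube is a multiple of
    itself. *)
Lemma reval_mx_antidiag (R : realType) (u v e : R) (f : ratfun R[i]) :
  rnum f = 'X - e%:C%C *: 'X^3 -> rden f = 1 ->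
  reval_mx f (antidiag u v) =
  antidiag ((1 - e * (u * v)) * u) ((1 - e * (u * v)) * v).
Proof.
rewrite /reval_mx => -> ->; rewrite rmorph1 invmx1 mulmx1 rmorphB /= linearZ /=.
rewrite rmorphXn /= horner_mx_X; apply/matrixP => i j.
rewrite !exprS expr0 mulr1 !mxE !(big_ord_recl, big_ord0, mxE) /=.
by case: (fintype.unliftP ord0 i) => [k|] ->;
  case: (fintype.unliftP ord0 j) => [l|] ->;
  rewrite ?ord1 /= ?(rmorphM, rmorphB, rmorph1) /=; ring.
Qed.

(* [A], [B], [s], [d] stand for [a^2], [b^2], [|z|^2], [Re (z^2)]; the last two
   hypotheses describe membership in the ellipse.  Any constant strictly
   between [A - B] and [A] could replace [A - B / 2]. *)
Lemma cubic_modulus_bound (R : realFieldType) (A B : R) : 0 < B -> B < A ->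
  exists e : R, [/\ 0 < e, e * A < 1 & forall s d, 0 <= s -> s <= A ->
    (A - B) * s - 2 * B * (A - s) <= (A - B) * d ->
    s * (1 - 2 * e * d + e ^+ 2 * s ^+ 2) <= A * (1 - e * (A - B / 2)) ^+ 2].
Proof.
move=> B0 BA; have A0 : 0 < A by apply: lt_trans BA.
set C := A - B; have C0 : 0 < C by rewrite subr_gt0.
(* Chosen so that [e * A^2] lies below both [C / 4] and [B]. *)
pose e := C * B / (A ^+ 2 * (4 * B + C)); exists e.
have D0 : 0 < 4 * B + C by lra.
have e0 : 0 < e by rewrite divr_gt0 ?mulr_gt0 ?exprn_gt0.
have eE : e * A ^+ 2 * (4 * B + C) = C * B.
  by rewrite /e; field; rewrite !gt_eqF.
have CE : C = A - B by [].
clearbody e C.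
have t0 : 0 < e * A ^+ 2 by rewrite mulr_gt0 ?exprn_gt0.
have eC : 4 * (e * A ^+ 2) <= C.
  rewrite -(ler_pM2r B0) -eE; have := mulr_gt0 t0 C0; lra.
have eB : e * A ^+ 2 <= B.
  rewrite -(ler_pM2l C0) -eE; have := mulr_gt0 t0 B0; lra.
split=> // [|s d s0 sA hd].
  by rewrite -(ltr_pM2r A0) -mulrA -expr2 mul1r (le_lt_trans eB).
have s3 : s ^+ 3 <= A ^+ 3 by rewrite lerXn2r ?nnegrE// ltW.
have lhs : e ^+ 2 * s ^+ 3 <= e ^+ 2 * A ^+ 3.
  by rewrite ler_wpM2l ?sqr_ge0.
(* After scaling by [C], the hypothesis bounds [C * d] directly. *)
rewrite -(ler_pM2l C0).
have h1 : s * (C * s - 2 * B * (A - s)) <= s * (C * d) by rewrite ler_wpM2l.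
(* The left side is the tangent at [s = A] to the convex quadratic on the right; they differ by
   [(A - s)^2 * (C + 2 * B)]. *)
have h2 : C * A ^+ 2 - 2 * (A - s) * A ^+ 2 <= s * (C * s - 2 * B * (A - s)).
  have : 0 <= (A - s) * (A - s) * (C + 2 * B).
    by rewrite !mulr_ge0 ?subr_ge0//; lra.
  rewrite CE => h; rewrite -subr_ge0; apply: le_trans h _.
  by rewrite le_eqVlt; apply/orP; left; apply/eqP; ring.
have h3 : e * (C * A ^+ 2 - 2 * (A - s) * A ^+ 2) <= e * (s * (C * d)).
  by rewrite ler_pM2l// (le_trans h2 h1).
have h4 : 0 <= (A - s) * (C - 4 * (e * A ^+ 2)).
  by rewrite mulr_ge0 ?subr_ge0.
have h5 : 0 <= e * C * A * (B - e * A ^+ 2).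
  by rewrite !mulr_ge0 ?subr_ge0 ?(ltW e0, ltW C0, ltW A0).
have h6 : C * (e ^+ 2 * s ^+ 3) <= C * (e ^+ 2 * A ^+ 3).
  by rewrite ler_pM2l.
have h7 : 0 <= C * (A * (e * (A - B / 2)) ^+ 2).
  by rewrite mulr_ge0 ?(ltW C0)// mulr_ge0 ?(ltW A0)// sqr_ge0.
rewrite -subr_ge0.
(* Every summand is nonnegative: the first two by the choice of [e], the third by the tangent bound,
   the fourth by [s <= A], the last as a multiple of a square. *)
have -> : C * (A * (1 - e * (A - B / 2)) ^+ 2)
    - C * (s * (1 - 2 * e * d + e ^+ 2 * s ^+ 2))
  = (A - s) * (C - 4 * (e * A ^+ 2)) + e * C * A * (B - e * A ^+ 2)
    + 2 * (e * (s * (C * d)) - e * (C * A ^+ 2 - 2 * (A - s) * A ^+ 2))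
    + (C * (e ^+ 2 * A ^+ 3) - C * (e ^+ 2 * s ^+ 3))
    + C * (A * (e * (A - B / 2)) ^+ 2) by rewrite CE; field.
apply: addr_ge0 h7; apply: addr_ge0; last by rewrite subr_ge0.
by apply: addr_ge0; [exact: addr_ge0 | rewrite mulr_ge0 ?subr_ge0].
Qed.

(** This is [|z|^2 |1 - e z^2|^2] expanded in terms of [|z|^2] and [Re (z^2)]. *)
Lemma cmod_cubic_sqr (R : realType) (e : R) (z : R[i]) :
  cmod (z - e%:C%C * z ^+ 3) ^+ 2 =
  (complex.Re z ^+ 2 + complex.Im z ^+ 2) *
  (1 - 2 * e * (complex.Re z ^+ 2 - complex.Im z ^+ 2)
   + e ^+ 2 * (complex.Re z ^+ 2 + complex.Im z ^+ 2) ^+ 2).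
Proof. by rewrite cmod_sqr !exprS expr0; case: z => p q /=; ring. Qed.

Theorem theorem1p8 (R : realType) (a b : R) (hb : 0 < b) (hab : b < a) :
  exists T : 'M[R[i]]_2,
    numerical_range T `<=` ellipse a b /\
    ~ W_spectral_pair T (ellipse a b) 0.
Proof.
have ha : 0 < a by apply: lt_trans hab.
have B0 : 0 < b ^+ 2 by rewrite exprn_gt0.
have BA : b ^+ 2 < a ^+ 2 by rewrite ltrXn2r ?nnegrE ?ltW.
have A0 : 0 < a ^+ 2 by rewrite exprn_gt0.
exists (antidiag (a + b) (a - b)); split.
  exact: numerical_range_antidiag.
have [e [e0 eA hcub]] := cubic_modulus_bound _ _ _ B0 BA.
set K := a ^+ 2 - b ^+ 2 / 2.
(* Makes [a * (1 - e * K)] nonnegative, so that moduli can be compared through their squares. *)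
have K1 : e * K < 1.
  by apply: le_lt_trans eA; rewrite ler_pM2l// gerBl divr_ge0 ?ltW.
pose f := @RatFun R[i] ('X - e%:C%C *: 'X^3) 1 (oner_neq0 _) (coprimep1 _).
case=> _ _ /(_ f) Wf.
have /Wf : forall z, is_pole f z -> ~ cclosure (ellipse a b) z.
  by move=> z; rewrite /is_pole /= (negPf (root1 z)).
have fE z : reval f z = z - e%:C%C * z ^+ 3.
  by rewrite /reval /= !hornerE divr1.
rewrite fE expr0n mulr0 subr0 => /(_ erefl).
have fle : (sup_mod (ellipse a b) (reval f) <= (a * (1 - e * K))%:E)%E.
  apply: ge_ereal_sup => _ [z hz <-]; rewrite lee_fin fE.
  have M0 : 0 <= a * (1 - e * K) by rewrite mulr_ge0 ?subr_ge0 ?ltW.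
  rewrite -(@ler_pXn2r _ 2) ?nnegrE ?cmod_ge0// cmod_cubic_sqr exprMn.
  set u := complex.Re z ^+ 2; set v := complex.Im z ^+ 2.
  have u0 : 0 <= u by exact: sqr_ge0.
  have v0 : 0 <= v by exact: sqr_ge0.
  have uv : b ^+ 2 * u + a ^+ 2 * v <= a ^+ 2 * b ^+ 2.
    move: hz; rewrite /ellipse /= -/u -/v -(ler_pM2l (mulr_gt0 A0 B0)) mulr1.
    by congr (_ <= _); field; rewrite !gt_eqF.
  (* With [s = u + v] and [d = u - v], the linear hypothesis is twice the inequality [uv],
     rearranged. *)
  apply: hcub; [exact: addr_ge0 | | lra].
  rewrite -(ler_pM2l B0); apply: le_trans (_ : b ^+ 2 * u + a ^+ 2 * v <= _).
    by rewrite mulrDr lerD2l ler_wpM2r// ltW.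
  by rewrite [leRHS]mulrC.
move=> /le_trans -/(_ _ fle); rewrite (@reval_mx_antidiag _ _ _ e)//.
move/(le_trans (antidiag_numerical_radius_ge _ _ _)); rewrite lee_fin.
move/(le_trans (ler_norm _)); apply/negP; rewrite -ltNge.
(* The gap between the radius bound [a * (1 - e * (a^2 - b^2))] and the bound for the supremum comes
   from [K] exceeding [a^2 - b^2] by [b^2 / 2]. *)
rewrite -subr_gt0 [ltRHS](_ : _ = a * e * (b ^+ 2 / 2)); last by rewrite /K; field.
by rewrite !mulr_gt0 ?invr_gt0.
Qed.
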